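(* Let $S$ be an inverse semigroup. The category $\mathsf{ConRepr}(S)$ of connected non-strict $S$-sets is a coreflective subcategory of the category $\mathsf{Repr}(S)$ of all non-strict $S$-sets, and the coreflector (the right adjoint of the inclusion functor $\mathsf{ConRepr}(S)\to\mathsf{Repr}(S)$) is given by the functor $\Psi\Phi$.
   Context: $S$ is an inverse semigroup, $E(S)$ its semilattice of idempotents, $\mathbf{d}(s)=s^{-1}s$, $\mathbf{r}(s)=ss^{-1}$, and $s\le t$ means $s=te$ for some $e\in E(S)$. $\mathcal{I}(X)$ is the symmetric inverse semigroup of all partial bijections of a set $X$. Loganathan's category $L(S)$: objects are the elements of $E(S)$; arrows are pairs $(f,s)$ with $f\in E(S)$, $s\in S$, $\mathbf{r}(s)\le f$, regarded as an arrow from $\mathbf{d}(s)$ to $f$; composition is $(f,s)(\mathbf{d}(s),t)=(f,st)$. The poset $E(S)$ maps to $L(S)$ by sending $e\le f$ to $(f,e)\colon e\to f$. Non-strict $S$-sets: a non-strict $S$-set $(X,\mu)$ is a set $X$ with a prehomomorphism $\mu\colon S\to\mathcal{I}(X)$, i.e. $\mu(ab)\le\mu(a)\mu(b)$ for all $a,b\in S$; write $s\cdot x=\mu(s)(x)$ where defined. Non-strict $S$-sets are always assumed effective: for every $x\in X$ there is $s\in S$ with $s\cdot x$ defined. A morphism $(X,\mu)\to(Y,\nu)$ is a map $f\colon X\to Y$ such that whenever $s\cdot x$ is defined, the action of $s$ on $f(x)$ is defined and equals $f(s\cdot x)$. A non-strict $S$-set is connected if for any $x\in X$ and $e,f\in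 E(S)$ with $e\cdot x$, $f\cdot x$ defined there is a sequence $e=e_1,\dots,e_k=f$ in $E(S)$ with each $e_i\cdot x$ defined and, for each $i<k$, $e_i\ge e_{i+1}$ or $e_i\le e_{i+1}$. $\mathsf{ConRepr}(S)$ is the full subcategory of connected ones in $\mathsf{Repr}(S)$. A subcategory $\mathcal{A}$ of $\mathcal{B}$ is coreflective if the inclusion $\mathcal{A}\to\mathcal{B}$ has a right adjoint, called a coreflector. Torsion-free functors: for a functor $F\colon L(S)\to\mathsf{Sets}$ let $\Psi(F)=\left(\bigcup_{e\in E(S)}\{e\}\times F(e)\right)/\sim$, where $\sim$ is the equivalence relation generated by $(e,x)\sim(e',F(e',e)(x))$ for $e\le e'$, $x\in F(e)$; $[e,x]$ denotes the class of $(e,x)$. $F$ is torsion-free if $(e,x)\sim(e,y)$ implies $x=y$. $\mathsf{TF}(L(S))$ has torsion-free functors as objects and natural transformations as morphisms. The functor $\Phi\colon \mathsf{Repr}(S)\to\mathsf{TF}(L(S))$: $\Phi(X,\mu)(e)=\{x\in X: e\cdot x \text{ is defined}\}$; $\Phi(X,\mu)(f,s)$ is the map $x\mapsto s\cdot x$ from $\Phi(X,\mu)(\mathbf{d}(s))$ to $\Phi(X,\mu)(f)$; on a morphism $g$, $\Phi(g)$ has components the restrictions of $g$. The functor $\Psi\colon\mathsf{TF}(L(S))\to\mathsf{ConRepr}(S)$: for $F$ torsion-free, $\Psi(F)$ carries the action where $s\circ\alpha$ is defined iff $\alpha=[\mathbf{d}(s),x]$ for some $x\in F(\mathbf{d}(s))$,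 and then $s\circ\alpha=[\mathbf{r}(s),F(\mathbf{r}(s),s)(x)]$. For a natural transformation $\alpha\colon F\to F'$, $\Psi(\alpha)$ is $[e,x]\mapsto[e,\alpha(e)(x)]$. *)

(* Defs.v *)
From HB Require Import structures.
From Stdlib Require Import Relation_Operators Operators_Properties.
From mathcomp Require Import all_boot boolp.

Set Implicit Arguments.
Unset Strict Implicit.
Unset Printing Implicit Defensive.

Local Open Scope group_scope.

Record category := Category {
  ob :> Type;
  hom : ob -> ob -> Type;
  idc : forall a, hom a a;
  compc : forall a b c, hom b c -> hom a b -> hom a c;
  comp1c : forall a b (f : hom a b), compc (idc b) f = f;
  compc1 : forall a b (f : hom a b), compc f (idc a) = f;
  compcA : forall a b c d (h : hom c d) (g : hom b c) (f : hom a b),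
    compc h (compc g f) = compc (compc h g) f }.

Arguments idc {_} _.
Arguments compc {_ _ _ _} _ _.

Record functor (C D : category) := Functor {
  fob :> C -> D;
  fmap : forall a b, hom a b -> hom (fob a) (fob b);
  fmap1 : forall a, fmap (idc a) = idc (fob a);
  fmapM : forall a b c (g : hom b c) (f : hom a b),
    fmap (compc g f) = compc (fmap g) (fmap f) }.

Arguments fmap {_ _} _ {_ _} _.

Lemma functor_comp_fmap1 (C D E : category) (G : functor D E)
    (F : functor C D) a : fmap G (fmap F (idc a)) = idc (G (F a)).
Proof. by rewrite !fmap1. Qed.

Lemma functor_comp_fmapM (C D E : category) (G : functor D E)
    (F : functor C D) a b c (g : hom b c) (f : hom a b) :
  fmap G (fmap F (compc g f)) =
  compc (fmap G (fmap F g)) (fmap G (fmap F f)).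
Proof. by rewrite !fmapM. Qed.

Definition functor_comp (C D E : category) (G : functor D E)
    (F : functor C D) : functor C E :=
  @Functor C E (fun a => G (F a)) (fun a b f => fmap G (fmap F f))
    (functor_comp_fmap1 G F) (functor_comp_fmapM G F).

Record nattrans (C D : category) (F G : functor C D) := NatTrans {
  ntob :> forall a : C, hom (F a) (G a);
  ntP : forall a b (f : hom a b),
    compc (ntob b) (fmap F f) = compc (fmap G f) (ntob a) }.

Lemma nattrans_eq (C D : category) (F G : functor C D) (s t : nattrans F G) :
  (forall a, s a = t a) -> s = t.
Proof.
case: s t => s sP [t tP] /= st.
have {}st : s = t by apply: functional_extensionality_dep.
by subst t; congr NatTrans; apply: Prop_irrelevance.
Qed.

Lemma nattrans_idP (C D : category) (F : functor C D) a b (f : hom a b) :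
  compc (idc (F b)) (fmap F f) = compc (fmap F f) (idc (F a)).
Proof. by rewrite comp1c compc1. Qed.

Definition nattrans_id (C D : category) (F : functor C D) : nattrans F F :=
  NatTrans (@nattrans_idP C D F).

Lemma nattrans_compP (C D : category) (F G H : functor C D)
    (t : nattrans G H) (s : nattrans F G) a b (f : hom a b) :
  compc (compc (t b) (s b)) (fmap F f) = compc (fmap H f) (compc (t a) (s a)).
Proof. by rewrite -compcA ntP compcA ntP -compcA. Qed.

Definition nattrans_comp (C D : category) (F G H : functor C D)
    (t : nattrans G H) (s : nattrans F G) : nattrans F H :=
  NatTrans (nattrans_compP t s).

Definition functor_cat (C D : category) : category.
Proof.
refine (@Category (functor C D) (@nattrans C D) (@nattrans_id C D)
  (@nattrans_comp C D) _ _ _).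
- by move=> F G s; apply: nattrans_eq => a; apply: comp1c.
- by move=> F G s; apply: nattrans_eq => a; apply: compc1.
- by move=> F G H K u t s; apply: nattrans_eq => a; apply: compcA.
Defined.

Definition Sets : category :=
  @Category Type (fun A B => A -> B) (fun A x => x)
    (fun A B C g f x => g (f x))
    (fun _ _ _ => erefl) (fun _ _ _ => erefl) (fun _ _ _ _ _ _ _ => erefl).

Definition full_subcat (C : category) (P : C -> Prop) : category :=
  @Category {a : C | P a} (fun a b => hom (sval a) (sval b))
    (fun a => idc (sval a)) (fun a b c g f => compc g f)
    (fun _ _ _ => comp1c _) (fun _ _ _ => compc1 _)
    (fun _ _ _ _ _ _ _ => compcA _ _ _).

Definition incl (C : category) (P : C -> Prop) : functor (full_subcat P) C :=
  @Functor (full_subcat P) C (fun a => sval a) (fun a b f => f)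
    (fun _ => erefl) (fun _ _ _ _ _ => erefl).

Record adjunction (C D : category) (F : functor C D) (G : functor D C) := Adj {
  adj_to : forall (c : C) (d : D), hom (F c) d -> hom c (G d);
  adj_from : forall (c : C) (d : D), hom c (G d) -> hom (F c) d;
  adj_toK : forall c d, cancel (@adj_to c d) (@adj_from c d);
  adj_fromK : forall c d, cancel (@adj_from c d) (@adj_to c d);
  adj_natl : forall c c' d (h : hom c' c) (f : hom (F c) d),
    adj_to (compc f (fmap F h)) = compc (adj_to f) h;
  adj_natr : forall c d d' (k : hom d d') (f : hom (F c) d),
    adj_to (compc k f) = compc (fmap G k) (adj_to f) }.

Definition right_adjoint (C D : category) (F : functor C D)
    (G : functor D C) : Prop := inhabited (adjunction F G).

(* Only full subcategories are needed; they are given by predicates on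
   objects. *)
Definition coreflector (C : category) (P : C -> Prop)
    (G : functor C (full_subcat P)) : Prop := right_adjoint (incl P) G.

Definition coreflective (C : category) (P : C -> Prop) : Prop :=
  exists G : functor C (full_subcat P), coreflector G.

HB.mixin Record Semigroup_isInverse S of Semigroup S := {
  sinv_existsU : forall s : S, exists! t : S, s * t * s = s /\ t * s * t = t }.

#[short(type="inverseSemigroupType")]
HB.structure Definition InverseSemigroup :=
  {S of Semigroup_isInverse S & Semigroup S}.

Definition sinv (S : inverseSemigroupType) (s : S) : S :=
  sval (cid (sinv_existsU s)).

Record idem (S : inverseSemigroupType) := Idem {
  ival :> S;
  idemP : ival * ival = ival }.

Definition nle (S : inverseSemigroupType) (s t : S) : Prop :=
  exists e : idem S, s = t * ival e.

Section InverseSemigroupTheory.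
Variable S : inverseSemigroupType.
Implicit Types (s t u : S) (e f g : idem S).

Lemma mulsVs s : s * sinv s * s = s.
Proof. by rewrite /sinv; case: cid => /= t [[]]. Qed.

Lemma mulVsV s : sinv s * s * sinv s = sinv s.
Proof. by rewrite /sinv; case: cid => /= t [[]]. Qed.

Lemma sinv_uniq s t : s * t * s = s -> t * s * t = t -> t = sinv s.
Proof.
move=> h1 h2; rewrite /sinv; case: cid => /= u [_ U].
by rewrite (U t).
Qed.

Lemma sinvK s : sinv (sinv s) = s.
Proof. by symmetry; apply: sinv_uniq; rewrite ?mulsVs ?mulVsV. Qed.

Lemma dom_idem s : (sinv s * s) * (sinv s * s) = sinv s * s.
Proof. by rewrite mulgA mulVsV. Qed.

Lemma ran_idem s : (s * sinv s) * (s * sinv s) = s * sinv s.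
Proof. by rewrite mulgA mulsVs. Qed.

Definition dS s : idem S := Idem (dom_idem s).
Definition rS s : idem S := Idem (ran_idem s).

Lemma idem_eq e f : e = f :> S -> e = f.
Proof.
case: e f => [e eP] [f fP] /= ef; subst f.
by congr Idem; apply: Prop_irrelevance.
Qed.

Lemma sinv_id (e : S) : e * e = e -> sinv e = e.
Proof. by move=> ee; rewrite -(@sinv_uniq e e) // !ee. Qed.

Lemma idemM_subproof (e f : S) : e * e = e -> f * f = f ->
  (e * f) * (e * f) = e * f.
Proof.
move=> ee ff; pose x := sinv (e * f).
have x1 : e * f * x * (e * f) = e * f := mulsVs _.
have x2 : x * (e * f) * x = x := mulVsV _.
have xE : f * x * e = x.
  apply: sinv_uniq.
    rewrite -[RHS]x1 !mulgA -(mulgA e f f) ff.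
    by rewrite -(mulgA (e * f * x) e e) ee.
  rewrite -[in RHS]x2 !mulgA -(mulgA (f * x) e e) ee.
  by rewrite -(mulgA _ f f) ff.
have xx : x * x = x.
  by rewrite -{1 2}xE -[RHS]xE -[in RHS]x2 !mulgA.
by rewrite -[e * f]sinvK -/x sinv_id // xx.
Qed.

Lemma idemC (e f : S) : e * e = e -> f * f = f -> e * f = f * e.
Proof.
move=> ee ff; rewrite -[LHS](sinv_id (idemM_subproof ee ff)).
symmetry; apply: sinv_uniq.
  rewrite !mulgA -(mulgA e f f) ff -(mulgA _ e e) ee -[e * f * e * f]mulgA.
  exact: idemM_subproof.
rewrite !mulgA -(mulgA f e e) ee -(mulgA _ f f) ff -[f * e * f * e]mulgA.
exact: idemM_subproof.
Qed.

Lemma idem_mulC e f : ival e * ival f = ival f * ival e.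
Proof. by apply: idemC; apply: idemP. Qed.

Definition idem_mul e f : idem S :=
  Idem (idemM_subproof (idemP e) (idemP f)).

Lemma sinvM s t : sinv (s * t) = sinv t * sinv s.
Proof.
symmetry; apply: sinv_uniq.
  rewrite !mulgA -(mulgA s t) -(mulgA s (t * _)) -(mulgA s _ s).
  rewrite -(mulgA (t * sinv t)) (idem_mulC (rS t) (dS s)) /= !mulgA mulsVs.
  by rewrite -!mulgA (mulgA t) mulsVs.
rewrite !mulgA -(mulgA (sinv t) (sinv s)) -(mulgA (sinv t) (_ * s)).
rewrite -(mulgA (sinv t) _ (sinv t)) -(mulgA (sinv s * s)).
rewrite (idem_mulC (dS s) (rS t)) /= !mulgA mulVsV.
by rewrite -!mulgA (mulgA (sinv s)) mulVsV.
Qed.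

Lemma dS_idem e : dS e = e.
Proof. by apply: idem_eq; rewrite /= sinv_id ?idemP. Qed.

Lemma rS_idem e : rS e = e.
Proof. by apply: idem_eq; rewrite /= sinv_id ?idemP. Qed.

Lemma mul_dS s : s * ival (dS s) = s.
Proof. by rewrite /= mulgA mulsVs. Qed.

Lemma rS_mul s : ival (rS s) * s = s.
Proof. exact: mulsVs. Qed.

Lemma nle_refl s : nle s s.
Proof. by exists (dS s); rewrite mul_dS. Qed.

Lemma nle_idemP e f : nle e f <-> ival f * ival e = ival e.
Proof.
split=> [[g ->]|fe]; first by rewrite mulgA idemP.
by exists e; rewrite fe.
Qed.

Lemma nle_idem_trans e f g : nle e f -> nle f g -> nle e g.
Proof.
move=> /nle_idemP ef /nle_idemP fg; apply/nle_idemP.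
by rewrite -ef mulgA fg.
Qed.

Lemma nle_rSP s f : nle (rS s) f <-> ival f * s = s.
Proof.
split=> [/nle_idemP fs|fs].
  by rewrite -[in LHS](rS_mul s) mulgA fs rS_mul.
by apply/nle_idemP; rewrite /= mulgA fs.
Qed.

Lemma rS_dSmul s t : nle (rS (ival (dS s) * t)) (dS s).
Proof. by apply/nle_rSP; rewrite mulgA idemP. Qed.

Lemma nle_rSM s t : nle (rS (s * t)) (rS s).
Proof. by apply/nle_rSP; rewrite mulgA rS_mul. Qed.

Lemma dSM s t f : dS s = f -> ival f * t = t -> dS (s * t) = dS t.
Proof.
move=> sf ft; apply: idem_eq.
have {}sf : sinv s * s = ival f by rewrite -sf.
by rewrite /= sinvM -!mulgA (mulgA (sinv s)) sf ft.
Qed.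

Lemma dS_dSmul s t : dS (ival (dS s) * t) = dS (s * t).
Proof.
apply: idem_eq; rewrite /= sinvM (sinv_id (dom_idem s)) sinvM -!mulgA.
by congr (_ * _); rewrite !mulgA mulVsV.
Qed.

Lemma nle_dSM s t : nle (dS (s * t)) (dS t).
Proof.
apply/nle_idemP; rewrite /= sinvM !mulgA.
by rewrite mulVsV.
Qed.

Lemma mul_dSM s t : t * ival (dS (s * t)) = ival (dS s) * t.
Proof.
rewrite /= sinvM !mulgA -(mulgA (t * _)) (idem_mulC (rS t) (dS s)) /=.
by rewrite -!mulgA (mulgA t) mulsVs.
Qed.

End InverseSemigroupTheory.

(* A partial bijection of [X], given by its graph. *)
Record pbij (X : Type) := PBij {
  pb_rel :> X -> X -> Prop;
  pb_fun : forall x y y', pb_rel x y -> pb_rel x y' -> y = y';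
  pb_inj : forall x x' y, pb_rel x y -> pb_rel x' y -> x = x' }.

Definition pb_defined (X : Type) (a : pbij X) (x : X) : Prop :=
  exists y, a x y.

Section SymmetricInverseSemigroup.
Variable X : Type.
Implicit Types a b c : pbij X.

Lemma pbij_eq a b : (forall x y, a x y <-> b x y) -> a = b.
Proof.
case: a b => [a af ai] [b bf bi] /= ab.
have {}ab : a = b by apply/funext => x; apply/funext => y; apply/propext.
by subst b; congr PBij; apply: Prop_irrelevance.
Qed.

(* As for composition of maps, [b] is applied first. *)
Definition pb_comp a b : pbij X.
Proof.
refine (@PBij X (fun x z => exists2 y, b x y & a y z) _ _).
- move=> x y y' [u bu au] [v bv av]; move: av.
  by rewrite -(pb_fun bu bv); apply: pb_fun.
- move=> x x' y [u bu au] [v bv av]; move: bv.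
  by rewrite -(pb_inj au av); apply: pb_inj.
Defined.

Lemma pb_compA : associative pb_comp.
Proof.
move=> a b c; apply: pbij_eq => x y /=; split.
  by move=> [z [w cw bz] az]; exists w => //; exists z.
by move=> [w cw [z bz az]]; exists z => //; exists w.
Qed.

HB.instance Definition _ := gen_eqMixin (pbij X).
HB.instance Definition _ := gen_choiceMixin (pbij X).
HB.instance Definition _ := isSemigroup.Build (pbij X) pb_compA.

Lemma pbM a b x z : (a * b)%g x z <-> exists2 y, b x y & a y z.
Proof. by []. Qed.

Definition pb_inv a : pbij X :=
  @PBij X (fun x y => a y x) (fun x y y' h h' => pb_inj h h')
    (fun x x' y h h' => pb_fun h h').

Lemma pb_mulVK a : a * pb_inv a * a = a.
Proof.
apply: pbij_eq => x y; split.
  by move=> [z xz [w zw wy]]; have /= -> := pb_inj xz zw.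
by move=> xy; exists y => //; exists x.
Qed.

Lemma pb_mulKV a : pb_inv a * a * pb_inv a = pb_inv a.
Proof.
apply: pbij_eq => x y; split.
  by move=> [z /= zx [w zw yw]]; rewrite (pb_fun zx zw).
by move=> xy; exists y => //; exists x.
Qed.

Lemma pb_inverseP a : exists! b, a * b * a = a /\ b * a * b = b.
Proof.
exists (pb_inv a); split; first by split; [exact: pb_mulVK | exact: pb_mulKV].
move=> b [aba bab]; apply: pbij_eq => x y /=; split=> [yx|xy].
  have : (a * b * a)%g y x by rewrite aba.
  by move=> [z yz [w zw wx]]; rewrite (pb_fun yx yz) (pb_inj yx wx).
have : (b * a * b)%g x y by rewrite bab.
by move=> [z xz [w zw wy]]; rewrite (pb_fun xy xz) (pb_inj xy wy).
Qed.

HB.instance Definition _ := Semigroup_isInverse.Build (pbij X) pb_inverseP.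

Lemma pbij_idem a : a * a = a -> forall x y, a x y -> x = y.
Proof.
move=> aa x y xy; have : (a * a)%g x y by rewrite aa.
by move=> [z xz zy]; rewrite (pb_inj xy zy) (pb_fun xy xz).
Qed.

Lemma pbij_nle a b : nle a b <-> forall x y, a x y -> b x y.
Proof.
split=> [[e ->] x y [z xz zy]|ab]; first by rewrite (pbij_idem (idemP e) xz).
exists (dS a); apply: pbij_eq => x y.
have VE : sinv a = pb_inv a.
  by symmetry; apply: sinv_uniq; [exact: pb_mulVK | exact: pb_mulKV].
rewrite /= VE; split.
  by move=> xy; exists x; [exists y | apply: ab].
move=> [z [w xw /= zw] zy]; rewrite (pb_inj xw zw).
by move: (zw) => /ab bzw; rewrite (pb_fun zy bzw).
Qed.

End SymmetricInverseSemigroup.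

Definition prehomomorphism (S T : inverseSemigroupType) (mu : S -> T) : Prop :=
  forall a b, nle (mu (a * b)) (mu a * mu b).

(* Since partial bijections are given by their graphs, [ns_act X s x y] says
   that s.x is defined and equal to y. *)
Record nsset (S : inverseSemigroupType) := NSSet {
  ns_car :> Type;
  ns_act : S -> pbij ns_car;
  ns_prehom : prehomomorphism ns_act;
  ns_effective : forall x, exists s, pb_defined (ns_act s) x }.

Arguments ns_act {S} _ _.

Section NSSetTheory.
Variables (S : inverseSemigroupType) (X : nsset S).
Implicit Types (s t : S) (e f : idem S) (x y z : X).

Lemma ns_actM s t x z : ns_act X (s * t) x z ->
  exists2 y, ns_act X t x y & ns_act X s y z.
Proof. by have /pbij_nle H := @ns_prehom S X s t; apply: H. Qed.

Lemma ns_act_idem e x y : ns_act X e x y -> x = y.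
Proof.
move=> xy; move: (xy); rewrite -{1}idemP => /ns_actM[z xz zy].
by rewrite (pb_inj xy zy) (pb_fun xy xz).
Qed.

Lemma ns_defined_act s x : pb_defined (ns_act X (dS s)) x ->
  pb_defined (ns_act X s) x.
Proof. by move=> [y /ns_actM[z xz _]]; exists z. Qed.

Lemma ns_act_le s f x y : nle (rS s) f -> ns_act X s x y ->
  pb_defined (ns_act X f) y.
Proof.
move=> /nle_rSP fs; rewrite -fs => /ns_actM[z _ zy].
by exists y; move: (zy); rewrite (ns_act_idem zy).
Qed.

End NSSetTheory.

Record nsmor (S : inverseSemigroupType) (X Y : nsset S) := NSMor {
  nsmor_fun :> X -> Y;
  nsmorP : forall s x y, ns_act X s x y ->
    ns_act Y s (nsmor_fun x) (nsmor_fun y) }.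

Lemma nsmor_eq (S : inverseSemigroupType) (X Y : nsset S) (f g : nsmor X Y) :
  f =1 g -> f = g.
Proof.
case: f g => f fP [g gP] /= /funext fg; subst g.
by congr NSMor; apply: Prop_irrelevance.
Qed.

Definition nsmor_id (S : inverseSemigroupType) (X : nsset S) : nsmor X X :=
  @NSMor S X X id (fun s x y xy => xy).

Definition nsmor_comp (S : inverseSemigroupType) (X Y Z : nsset S)
    (g : nsmor Y Z) (f : nsmor X Y) : nsmor X Z :=
  @NSMor S X Z (fun x => g (f x)) (fun s x y xy => nsmorP g (nsmorP f xy)).

Definition Repr (S : inverseSemigroupType) : category.
Proof.
refine (@Category (nsset S) (@nsmor S) (@nsmor_id S) (@nsmor_comp S) _ _ _).
- by move=> X Y f; apply: nsmor_eq.
- by move=> X Y f; apply: nsmor_eq.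
- by move=> X Y Z W h g f; apply: nsmor_eq.
Defined.

(* The sequence of idempotents is [es 0, ..., es k]. *)
Definition connected (S : inverseSemigroupType) (X : Repr S) : Prop :=
  forall (x : ns_car X) (e f : idem S),
    pb_defined (ns_act X e) x -> pb_defined (ns_act X f) x ->
  exists (k : nat) (es : nat -> idem S),
    [/\ es 0%N = e, es k = f,
        forall i, (i <= k)%N -> pb_defined (ns_act X (es i)) x
      & forall i, (i < k)%N -> nle (es i.+1) (es i) \/ nle (es i) (es i.+1)].

Definition ConRepr (S : inverseSemigroupType) : category :=
  full_subcat (@connected S).

(* An arrow [(f, s)] from [e = d(s)] to [f]. *)
Record larr (S : inverseSemigroupType) (e f : idem S) := LArr {
  lval :> S;
  larr_d : dS lval = e;
  larr_r : nle (rS lval) f }.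

Section Loganathan.
Variable S : inverseSemigroupType.
Implicit Types (s t : S) (e f g : idem S).

Lemma larr_eq e f (a b : larr e f) : a = b :> S -> a = b.
Proof.
case: a b => [a ad ar] [b bd br] /= ab; subst b.
by congr LArr; apply: Prop_irrelevance.
Qed.

Lemma larr_mulr e f (a : larr e f) : lval a * ival e = lval a.
Proof. by case: a => s sd sr /=; rewrite -sd mul_dS. Qed.

Lemma larr_mull e f (a : larr e f) : ival f * lval a = lval a.
Proof. by apply/nle_rSP/larr_r. Qed.

Lemma nle_larr_r e f : nle e f -> nle (rS e) f.
Proof. by rewrite rS_idem. Qed.

Definition larr_le e f (ef : nle e f) : larr e f :=
  LArr (dS_idem e) (nle_larr_r ef).

Definition larr_id e : larr e e := larr_le (nle_refl e).

Lemma larr_comp_d e f g (a : larr f g) (b : larr e f) : dS (lval a * lval b) = e.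
Proof. by rewrite (dSM (larr_d a)) ?larr_d // larr_mull. Qed.

Lemma larr_comp_r e f g (a : larr f g) (b : larr e f) : nle (rS (lval a * lval b)) g.
Proof. by apply/nle_rSP; rewrite mulgA larr_mull. Qed.

Definition larr_comp e f g (a : larr f g) (b : larr e f) : larr e g :=
  LArr (larr_comp_d a b) (larr_comp_r a b).

(* The arrow [(r(s), s)] from [d(s)] to [r(s)]. *)
Definition larr_of s : larr (dS s) (rS s) := LArr (erefl _) (nle_refl (rS s)).

Definition Lcat : category.
Proof.
refine (@Category (idem S) (@larr S) larr_id larr_comp _ _ _).
- by move=> e f a; apply: larr_eq; apply: larr_mull.
- by move=> e f a; apply: larr_eq; apply: larr_mulr.
- by move=> e f g h a b c; apply: larr_eq; apply: mulgA.
Defined.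

End Loganathan.

Section TorsionFree.
Variables (S : inverseSemigroupType) (F : functor (Lcat S) Sets).

Definition elt : Type := {e : idem S & F e}.

Definition mkelt (e : idem S) (x : F e) : elt := existT _ e x.

Inductive elt_step : elt -> elt -> Prop :=
  EltStep (e e' : idem S) (ee' : nle e e') (x : F e) :
    elt_step (mkelt x) (mkelt (fmap F (larr_le ee' : @hom (Lcat S) e e') x)).

Definition elt_sim : elt -> elt -> Prop := clos_refl_sym_trans elt elt_step.

Definition torsion_free : Prop :=
  forall (e : idem S) (x y : F e), elt_sim (mkelt x) (mkelt y) -> x = y.

(* The quotient of [elt] by [elt_sim], as the type of equivalence classes. *)
Record psi_car := PsiCar {
  psi_class :> elt -> Prop;
  psi_classP : exists p, psi_class = elt_sim p }.

Definition elt_class (p : elt) : psi_car :=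
  PsiCar (ex_intro _ p (erefl (elt_sim p))).

(* The class [e, x]. *)
Definition psi_cl (e : idem S) (x : F e) : psi_car := elt_class (mkelt x).

Lemma elt_classE p q : elt_class p = elt_class q <-> elt_sim p q.
Proof.
split=> [[pq]|pq]; first by rewrite pq; apply: rst_refl.
have {}pq : elt_sim p = elt_sim q.
  apply/funext => r; apply/propext; split=> [pr|qr].
    by apply: rst_trans pr; apply: rst_sym.
  exact: rst_trans qr.
rewrite /elt_class; move: (ex_intro _ q _) (ex_intro _ p _) => /= h1 h2.
move: h1 h2; rewrite pq => h1 h2.
by congr PsiCar; apply: Prop_irrelevance.
Qed.

Lemma psi_car_eq (c d : psi_car) : psi_class c = psi_class d -> c = d.
Proof.
case: c d => [c cP] [d dP] /= cd; subst d.
by congr PsiCar; apply: Prop_irrelevance.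
Qed.

Definition psi_repr (c : psi_car) : elt := sval (cid (psi_classP c)).

Lemma psi_reprK c : elt_class (psi_repr c) = c.
Proof. by rewrite /psi_repr; case: cid => p pP; apply: psi_car_eq. Qed.

Lemma psi_carP c : exists (e : idem S) (x : F e), c = psi_cl x.
Proof.
exists (tag (psi_repr c)), (tagged (psi_repr c)).
by rewrite -[LHS]psi_reprK /psi_cl /mkelt; case: (psi_repr c).
Qed.

Lemma psi_cl_le (e e' : idem S) (ee' : nle e e') (x : F e) :
  psi_cl (fmap F (larr_le ee' : @hom (Lcat S) e e') x) = psi_cl x.
Proof. by apply/elt_classE; apply: rst_sym; apply: rst_step. Qed.

End TorsionFree.

Definition TF (S : inverseSemigroupType) : category :=
  full_subcat (C := functor_cat (Lcat S) Sets) (@torsion_free S).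

Section PhiOb.
Variables (S : inverseSemigroupType) (X : nsset S).

Definition phi_ob (e : idem S) : Type :=
  {x : X | pb_defined (ns_act X e) x}.

Lemma phi_map_ex (e f : idem S) (a : larr e f) (x : phi_ob e) :
  exists y : phi_ob f, ns_act X a (sval x) (sval y).
Proof.
case: a x => [s sd sr] [x xe] /=; subst e.
have [y xy] := ns_defined_act xe.
by exists (exist _ y (ns_act_le sr xy)).
Qed.

Definition phi_map (e f : idem S) (a : larr e f) (x : phi_ob e) : phi_ob f :=
  sval (cid (phi_map_ex a x)).

Lemma phi_mapP (e f : idem S) (a : larr e f) (x : phi_ob e) :
  ns_act X a (sval x) (sval (phi_map a x)).
Proof. by rewrite /phi_map; case: cid. Qed.

Lemma phi_ob_eq (e : idem S) (x y : phi_ob e) : sval x = sval y -> x = y.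
Proof. by case: x y => [x xP] [y yP] /= xy; apply: eq_exist. Qed.

Lemma phi_mapE (e f : idem S) (a : larr e f) (x : phi_ob e) (y : phi_ob f) :
  ns_act X a (sval x) (sval y) -> phi_map a x = y.
Proof. by move=> xy; apply/phi_ob_eq/(pb_fun (phi_mapP a x) xy). Qed.

Lemma phi_map1 (e : idem S) : phi_map (larr_id e) = id.
Proof.
apply/funext => -[x [y xy]]; apply: phi_mapE => /=.
by rewrite {2}(ns_act_idem xy).
Qed.

Lemma phi_mapM (e f g : idem S) (a : larr f g) (b : larr e f) :
  phi_map (larr_comp a b) = fun x => phi_map a (phi_map b x).
Proof.
apply/funext => x; symmetry; apply: phi_ob_eq.
have [y xy yz] := ns_actM (phi_mapP (larr_comp a b) x).
have h := pb_fun (phi_mapP b x) xy.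
by apply: pb_fun yz; rewrite -h; apply: phi_mapP.
Qed.

Definition phi_functor : functor (Lcat S) Sets :=
  @Functor (Lcat S) Sets phi_ob phi_map phi_map1 phi_mapM.

Lemma phi_elt_sim (p q : elt phi_functor) : elt_sim p q ->
  sval (tagged p) = sval (tagged q).
Proof.
elim=> {p q} [_ _ [e e' ee' x] /=|p|p q _ ->|p q r _ -> _ ->] //.
exact: ns_act_idem (phi_mapP (larr_le ee') x).
Qed.

Lemma phi_torsion_free : torsion_free phi_functor.
Proof. by move=> e x y /phi_elt_sim/phi_ob_eq. Qed.

Definition phi_tf : TF S := exist _ phi_functor phi_torsion_free.

End PhiOb.

Section PhiMor.
Variable S : inverseSemigroupType.

Lemma phi_mor_subproof (X Y : nsset S) (g : nsmor X Y) (e : idem S) x :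
  pb_defined (ns_act X e) x -> pb_defined (ns_act Y e) (g x).
Proof. by move=> [y xy]; exists (g y); apply: nsmorP. Qed.

Definition phi_mor_at (X Y : nsset S) (g : nsmor X Y) (e : idem S)
    (x : phi_ob X e) : phi_ob Y e :=
  exist _ (g (sval x)) (phi_mor_subproof g (svalP x)).

Lemma phi_mor_nat (X Y : nsset S) (g : nsmor X Y) (e f : idem S)
    (a : larr e f) :
  (fun x => phi_mor_at g (phi_map a x)) =
  (fun x => phi_map a (phi_mor_at g x)).
Proof.
apply/funext => x; symmetry; apply: phi_mapE => /=.
by apply: nsmorP; apply: phi_mapP.
Qed.

Definition phi_mor (X Y : nsset S) (g : nsmor X Y) :
    nattrans (phi_functor X) (phi_functor Y) :=
  @NatTrans (Lcat S) Sets (phi_functor X) (phi_functor Y) (phi_mor_at g)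
    (@phi_mor_nat X Y g).

Definition Phi : functor (Repr S) (TF S).
Proof.
refine (@Functor (Repr S) (TF S) (@phi_tf S) phi_mor _ _).
- move=> X; apply: nattrans_eq => e; apply/funext => x.
  exact: phi_ob_eq.
- move=> X Y Z g f; apply: nattrans_eq => e; apply/funext => x.
  exact: phi_ob_eq.
Defined.

End PhiMor.

Section PsiOb.
Variables (S : inverseSemigroupType) (F : functor (Lcat S) Sets).
Hypothesis tfF : torsion_free F.
Implicit Types (s t : S) (al be : psi_car F).

Local Notation Fmap a := (@fmap (Lcat S) Sets F _ _ a).

Lemma psi_cl_inj (e : idem S) (x y : F e) : psi_cl x = psi_cl y -> x = y.
Proof. by move=> /elt_classE/tfF. Qed.

Lemma FmapM (e f g : idem S) (a : larr f g) (b : larr e f) x :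
  Fmap (larr_comp a b) x = Fmap a (Fmap b x).
Proof. by rewrite (@fmapM _ _ F e f g a b). Qed.

Lemma larr_inv_d s : dS (sinv s) = rS s.
Proof. by apply: idem_eq; rewrite /= sinvK. Qed.

Lemma larr_inv_r s : nle (rS (sinv s)) (dS s).
Proof. by apply/nle_rSP; rewrite /= mulVsV. Qed.

Definition larr_inv s : larr (rS s) (dS s) := LArr (larr_inv_d s) (larr_inv_r s).

Lemma Fmap_larrK s : cancel (Fmap (larr_of s)) (Fmap (larr_inv s)).
Proof.
move=> x; rewrite -FmapM.
have -> : larr_comp (larr_inv s) (larr_of s) = larr_id (dS s).
  exact: larr_eq.
by rewrite (@fmap1 _ _ F (dS s)).
Qed.

Lemma psi_cl_larr (e f f' : idem S) (a : larr e f) (a' : larr e f') x :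
  lval a = lval a' -> psi_cl (Fmap a x) = psi_cl (Fmap a' x).
Proof.
suff H g (b : larr e g) : exists y : F (rS b),
    psi_cl (Fmap b x) = psi_cl y /\
    forall c : larr e (rS b), lval c = lval b -> y = Fmap c x.
  case: a a' => [s sd sr] [s' sd' sr'] /= ss'; subst s'.
  have [y [-> yE]] := H _ (LArr sd sr).
  have [y' [-> yE']] := H _ (LArr sd' sr').
  pose c : larr e (rS s) := LArr sd (nle_refl _).
  by rewrite (yE c) // (yE' c).
case: b => [s sd sr] /=.
pose c : larr e (rS s) := LArr sd (nle_refl _).
exists (Fmap c x); split; last first.
  by move=> d dE; congr (Fmap _ x); apply: larr_eq.
rewrite -(psi_cl_le sr) -FmapM; congr (psi_cl (Fmap _ x)).
by apply: larr_eq; rewrite /= mulsVs.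
Qed.

Definition psi_rel (s : S) (al be : psi_car F) : Prop :=
  exists x : F (dS s), al = psi_cl x /\ be = psi_cl (Fmap (larr_of s) x).

Lemma psi_rel_fun s al be be' :
  psi_rel s al be -> psi_rel s al be' -> be = be'.
Proof. by move=> [x [-> ->]] [y [/psi_cl_inj-> ->]]. Qed.

Lemma psi_rel_inj s al al' be :
  psi_rel s al be -> psi_rel s al' be -> al = al'.
Proof.
move=> [x [-> ->]] [y [-> /psi_cl_inj xy]].
by rewrite -[x]Fmap_larrK xy Fmap_larrK.
Qed.

(* [s o al] is defined iff [al = [d(s), x]] for some [x], and then
   [s o al = [r(s), F(r(s), s)(x)]]. *)
Definition psi_act (s : S) : pbij (psi_car F) :=
  PBij (@psi_rel_fun s) (@psi_rel_inj s).

Lemma psi_act_larr (e f : idem S) (a : larr e f) (x : F e) :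
  psi_act (lval a) (psi_cl x) (psi_cl (Fmap a x)).
Proof.
case: a => [s sd sr] /=; subst e; exists x; split=> //.
exact: psi_cl_larr.
Qed.

Lemma psi_act_prehom : prehomomorphism psi_act.
Proof.
move=> s t; apply/pbij_nle => al be [x [-> ->]].
have r1 := rS_dSmul s t.
pose a1 : larr (dS (s * t)) (dS s) := LArr (dS_dSmul s t) r1.
pose a2 := larr_comp (larr_of t) (larr_le (nle_dSM s t)).
exists (psi_cl (Fmap a1 x)).
  have -> : psi_cl (Fmap a1 x) = psi_cl (Fmap a2 x).
    by apply: psi_cl_larr; symmetry; apply: mul_dSM.
  rewrite /a2 FmapM -(psi_cl_le (nle_dSM s t) x).
  exact: (psi_act_larr (larr_of t)).
have -> : psi_cl (Fmap (larr_of (s * t)) x) =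
    psi_cl (Fmap (larr_comp (larr_of s) a1) x).
  by apply: psi_cl_larr; rewrite /= !mulgA mulsVs.
by rewrite FmapM; apply: (psi_act_larr (larr_of s)).
Qed.

Lemma psi_definedP (e : idem S) al :
  pb_defined (psi_act e) al <-> exists x : F e, al = psi_cl x.
Proof.
split=> [[be [x [-> _]]]|[x ->]].
  by move: x; rewrite dS_idem => x; exists x.
by exists (psi_cl (Fmap (larr_id e) x)); apply: (psi_act_larr (larr_id e)).
Qed.

Lemma psi_act_effective al : exists s, pb_defined (psi_act s) al.
Proof.
have [e [x ->]] := psi_carP al.
by exists e; apply/psi_definedP; exists x.
Qed.

Definition psi_nsset : nsset S := NSSet psi_act_prehom psi_act_effective.

Lemma psi_connected : connected psi_nsset.
Proof.
move=> /= al e f /psi_definedP[x alx] /psi_definedP[y aly].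
have : elt_sim (mkelt x) (mkelt y) by apply/elt_classE; rewrite -[LHS]alx.
move/clos_rst_rstn1_iff.
have : tag (mkelt y) = f by [].
move: (mkelt y) => r <-.
elim=> [|p q pq].
  exists 0%N, (fun=> e); split=> // i _.
  by apply/psi_definedP; exists x.
move=> /clos_rst_rstn1_iff xp [k [es [es0 esk esd esle]]].
exists k.+1, (fun i => if (i <= k)%N then es i else tag q); split=> //.
- by rewrite ltnn.
- move=> i _; case: ifP => [|_]; first exact: esd.
  apply/psi_definedP; exists (tagged q).
  rewrite alx; have -> : psi_cl (tagged q) = elt_class q.
    by rewrite /psi_cl /mkelt; case: (q).
  apply/elt_classE; apply: rst_trans xp _.
  by case: pq => h; [|apply: rst_sym]; apply: rst_step.
- move=> i; rewrite ltnS => ik; rewrite ik; case: ltnP => ki; first exact: esle.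
  have -> : i = k by apply/eqP; rewrite eqn_leq ik ki.
  by rewrite esk; case: pq => -[] *; [right|left].
Qed.

Definition psi_con : ConRepr S := exist _ psi_nsset psi_connected.

End PsiOb.

Section PsiMor.
Variable S : inverseSemigroupType.

Section Map.
Variables (F G : functor (Lcat S) Sets) (t : nattrans F G).

Definition elt_map (p : elt F) : elt G := mkelt (t (tag p) (tagged p)).

Lemma elt_map_sim p q : elt_sim p q -> elt_sim (elt_map p) (elt_map q).
Proof.
elim=> {p q} [_ _ [e e' ee' x]|p|p q _ pq|p q r _ pq _ qr].
- rewrite /elt_map /=.
  have /(congr1 (fun h => h x)) /= -> := ntP t (larr_le ee' : @hom (Lcat S) e e').
  exact/rst_step/EltStep.
- exact: rst_refl.
- exact: rst_sym.
- exact: rst_trans pq qr.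
Qed.

(* [psi_map] sends [e, x] to [e, t e x]: see [psi_map_cl]. *)
Definition psi_map (c : psi_car F) : psi_car G :=
  elt_class (elt_map (psi_repr c)).

Lemma psi_map_cl (e : idem S) (x : F e) : psi_map (psi_cl x) = psi_cl (t e x).
Proof.
apply/elt_classE; apply: (elt_map_sim (q := mkelt x)).
by apply/elt_classE; apply: psi_reprK.
Qed.

Hypotheses (tfF : torsion_free F) (tfG : torsion_free G).

Lemma psi_mapP s al be :
  psi_act tfF s al be -> psi_act tfG s (psi_map al) (psi_map be).
Proof.
move=> [x [-> ->]]; rewrite !psi_map_cl; exists (t (dS s) x); split=> //.
have /(congr1 (fun h => h x)) /= -> //:=
  ntP t (larr_of s : @hom (Lcat S) (dS s) (rS s)).
Qed.

Definition psi_mor : nsmor (psi_nsset tfF) (psi_nsset tfG) :=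
  @NSMor S (psi_nsset tfF) (psi_nsset tfG) psi_map psi_mapP.

End Map.

Definition Psi : functor (TF S) (ConRepr S).
Proof.
refine (@Functor (TF S) (ConRepr S) (fun F => psi_con (proj2_sig F))
  (fun F G t => psi_mor t (proj2_sig F) (proj2_sig G)) _ _).
- move=> F; apply: nsmor_eq => c.
  by have [e [x ->]] := psi_carP c; rewrite /= psi_map_cl.
- move=> F G H u t; apply: nsmor_eq => c.
  by have [e [x ->]] := psi_carP c; rewrite /= !psi_map_cl.
Defined.

End PsiMor.

(* Main.v *)
From mathcomp Require Import all_boot boolp.
Require Import Defs.

(** The points of [Psi (Phi Y)] are the classes [[e, y]] with [e] an idempotent
    and [e.y] defined, and the relation identifies [(e, y)] with [(f, y)]
    exactly when [e] and [f] are joined by a zigzag of comparable idempotents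
    defined at [y].  So [Psi (Phi Y)] is [Y] with each point split into its
    connected components, and the counit of the adjunction is the map
    [counit Y : [e, y] |-> y] that forgets the component.

    Two facts make the counit couniversal among morphisms from connected sets.
    First, a component is determined by its point and any one idempotent
    defined there: if [e.al] is defined in [Psi (Phi Y)], then
    [al = [e, counit Y al]] ([germ_counit]).  Secondly, if [X] is connected,
    every point has a single component, so that [x |-> [e, x]] does not depend
    on [e] and is a morphism [con_unit : X -> Psi (Phi X)].  A morphism
    [f : X -> Y] then lifts to [Psi (Phi f) \o con_unit], i.e. to
    [x |-> [e, f x]].  Conversely
    a morphism [g : X -> Psi (Phi Y)] preserves definedness, so [e.(g x)] is
    defined whenever [e.x] is, and the first fact gives
    [g x = [e, counit Y (g x)]]: the lift of [counit Y \o g] is [g]. *)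

Set Implicit Arguments.
Unset Strict Implicit.
Unset Printing Implicit Defensive.

Local Open Scope group_scope.

Section Idempotents.
Variables (S : inverseSemigroupType) (X : nsset S).

Lemma ns_defined_dS (s : S) (x : X) :
  pb_defined (ns_act X s) x -> pb_defined (ns_act X (dS s)) x.
Proof. by case=> y; rewrite -{1}(mul_dS s) => /ns_actM[z xz _]; exists z. Qed.

Lemma ns_effective_idem (x : X) : exists e : idem S, pb_defined (ns_act X e) x.
Proof.
by have [s /ns_defined_dS xs] := ns_effective x; exists (dS s).
Qed.

End Idempotents.

Section Germ.
Variables (S : inverseSemigroupType) (X : nsset S).

Definition germ (e : idem S) (x : X) (xe : pb_defined (ns_act X e) x) :
    psi_car (phi_functor X) :=
  @psi_cl S (phi_functor X) e (exist _ x xe).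

(** Only the idempotent and the point matter: this transports a germ along an
    equality of points. *)
Lemma germ_eq (e : idem S) (x y : X) (xe : pb_defined (ns_act X e) x)
    (ye : pb_defined (ns_act X e) y) : x = y -> germ xe = germ ye.
Proof. by move=> xy; congr psi_cl; apply: phi_ob_eq. Qed.

Lemma germ_le (e f : idem S) (x : X) (xe : pb_defined (ns_act X e) x)
    (xf : pb_defined (ns_act X f) x) : nle e f -> germ xe = germ xf.
Proof.
move=> ef; rewrite /germ -(psi_cl_le ef); congr psi_cl.
by apply: phi_mapE => /=; case: xe => y xy; rewrite {2}(ns_act_idem xy).
Qed.

(** Each comparability in the zigzag given by connectedness is one of the
    identifications that generate the equivalence of [Psi]. *)
Lemma germ_connected (conX : connected X) (e f : idem S) (x : X)
    (xe : pb_defined (ns_act X e) x) (xf : pb_defined (ns_act X f) x) :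
  germ xe = germ xf.
Proof.
have [k [es [es0 esk esd esle]]] := conX x e f xe xf.
suff H i : (i <= k)%N -> forall xi : pb_defined (ns_act X (es i)) x,
    germ xe = germ xi by subst f; apply: H.
elim: i => [_ xi|i IHi ik xi]; first by subst e; apply: germ_eq.
rewrite (IHi (ltnW ik) (esd i (ltnW ik))).
by have [h|h] := esle i ik; [symmetry|]; apply: germ_le.
Qed.

Lemma germ_act (s : S) (x y : X) (xs : pb_defined (ns_act X (dS s)) x)
    (yr : pb_defined (ns_act X (rS s)) y) :
  ns_act X s x y ->
  ns_act (psi_nsset (@phi_torsion_free S X)) s (germ xs) (germ yr).
Proof.
move=> xy; exists (exist _ x xs); split=> //; congr psi_cl.
by symmetry; apply: phi_mapE.
Qed.

End Germ.

Section Counit.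
Variables (S : inverseSemigroupType) (X : nsset S).
Local Notation PsiPhi Y := (psi_nsset (@phi_torsion_free S Y)).

Definition counit_fun (c : PsiPhi X) : X := sval (tagged (psi_repr c)).

(** All representatives of a class have the same point, so it may be read off
    the arbitrary one chosen by [psi_repr]. *)
Lemma counit_cl (e : idem S) (x : phi_ob X e) :
  counit_fun (@psi_cl S (phi_functor X) e x) = sval x.
Proof.
apply: (@phi_elt_sim S X _ (@mkelt S (phi_functor X) e x)).
by apply/elt_classE; apply: psi_reprK.
Qed.

Lemma counitP (s : S) (al be : PsiPhi X) : ns_act (PsiPhi X) s al be ->
  ns_act X s (counit_fun al) (counit_fun be).
Proof. by move=> [x [-> ->]]; rewrite !counit_cl; apply: phi_mapP. Qed.

Definition counit : nsmor (PsiPhi X) X := NSMor counitP.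

(** An idempotent [e] is defined at [al] precisely when [al] has
    a representative at [e], and the counit reads off its point. *)
Lemma germ_counit (e : idem S) (al : PsiPhi X)
    (xe : pb_defined (ns_act X e) (counit al)) :
  pb_defined (ns_act (PsiPhi X) e) al -> germ xe = al.
Proof.
move=> /psi_definedP[x alx]; rewrite [RHS]alx; congr psi_cl.
by apply: phi_ob_eq; rewrite /= alx counit_cl.
Qed.

End Counit.

Section Unit.
Variables (S : inverseSemigroupType) (X : nsset S).
Hypothesis conX : connected X.
Local Notation PsiPhi Y := (psi_nsset (@phi_torsion_free S Y)).

Definition unit_fun (x : X) : PsiPhi X :=
  germ (svalP (cid (ns_effective_idem x))).

Lemma unit_germ (e : idem S) (x : X) (xe : pb_defined (ns_act X e) x) :
  unit_fun x = germ xe.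
Proof. exact: germ_connected. Qed.

Lemma unitP (s : S) (x y : X) : ns_act X s x y ->
  ns_act (PsiPhi X) s (unit_fun x) (unit_fun y).
Proof.
move=> xy; have xs := ns_defined_dS (ex_intro _ y xy).
have yr := ns_act_le (nle_refl (rS s)) xy.
by rewrite (unit_germ xs) (unit_germ yr); apply: germ_act.
Qed.

Definition con_unit : nsmor X (PsiPhi X) := NSMor unitP.

End Unit.

Section Naturality.
Variables (S : inverseSemigroupType) (X Y : nsset S) (f : nsmor X Y).
Local Notation PsiPhi Y := (psi_nsset (@phi_torsion_free S Y)).

Definition psi_phi_mor : nsmor (PsiPhi X) (PsiPhi Y) :=
  psi_mor (phi_mor f) (@phi_torsion_free S X) (@phi_torsion_free S Y).

Lemma psi_phi_mor_germ (e : idem S) (x : X) (xe : pb_defined (ns_act X e) x) :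
  psi_phi_mor (germ xe) = germ (phi_mor_subproof f xe).
Proof. by rewrite /= psi_map_cl; apply: germ_eq. Qed.

Lemma unit_nat (conX : connected X) (conY : connected Y) (x : X) :
  psi_phi_mor (con_unit conX x) = con_unit conY (f x).
Proof. by rewrite psi_phi_mor_germ; symmetry; apply: unit_germ. Qed.

End Naturality.

Section Adjunction.
Variable S : inverseSemigroupType.
Local Notation PsiPhi Y := (psi_nsset (@phi_torsion_free S Y)).

Definition lift (X Y : nsset S) (conX : connected X) (f : nsmor X Y) :
    nsmor X (PsiPhi Y) :=
  nsmor_comp (psi_phi_mor f) (con_unit conX).

Definition unlift (X Y : nsset S) (g : nsmor X (PsiPhi Y)) : nsmor X Y :=
  nsmor_comp (counit Y) g.

Lemma liftK (X Y : nsset S) (conX : connected X) :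
  cancel (@lift X Y conX) (@unlift X Y).
Proof.
by move=> f; apply: nsmor_eq => x; rewrite /= psi_map_cl counit_cl.
Qed.

Lemma unliftK (X Y : nsset S) (conX : connected X) :
  cancel (@unlift X Y) (@lift X Y conX).
Proof.
move=> g; apply: nsmor_eq => x.
(* Any idempotent at [x] is also defined at [g x], hence serves both sides. *)
have [e xe] := ns_effective_idem x.
have -> : lift conX (unlift g) x = germ (phi_mor_subproof (unlift g) xe).
  by rewrite -psi_phi_mor_germ -(unit_germ conX).
exact/germ_counit/phi_mor_subproof.
Qed.

Lemma psi_phi_adjunction :
  adjunction (incl (@connected S)) (functor_comp (Psi S) (Phi S)).
Proof.
refine (@Adj (ConRepr S) (Repr S) (incl (@connected S))
  (functor_comp (Psi S) (Phi S))
  (fun X Y f => lift (proj2_sig X) f) (fun X Y g => unlift g)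
  (fun X Y => liftK (proj2_sig X)) (fun X Y => unliftK (proj2_sig X)) _ _).
- move=> X X' Y h f; apply: nsmor_eq => x.
  have /(congr1 (fun k : nsmor _ _ => k (con_unit (proj2_sig X') x))) :=
    fmapM (functor_comp (Psi S) (Phi S)) f h.
  move=> /= ->; congr (psi_phi_mor f _).
  exact: (unit_nat h (proj2_sig X') (proj2_sig X) x).
- move=> X Y Y' k f; apply: nsmor_eq => x.
  exact: (congr1 (fun h : nsmor _ _ => h (con_unit (proj2_sig X) x))
    (fmapM (functor_comp (Psi S) (Phi S)) k f)).
Qed.

End Adjunction.

Theorem proposition12 (S : inverseSemigroupType) :
  coreflective (@connected S) /\
  coreflector (P := @connected S) (functor_comp (Psi S) (Phi S)).
Proof.
have adj : coreflector (P := @connected S) (functor_comp (Psi S) (Phi S)).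
  exact: inhabits (psi_phi_adjunction S).
by split=> //; exists (functor_comp (Psi S) (Phi S)).
Qed.
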